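(* Let $n\geq 3$ be an integer. The only $n$-prism graph $\mathcal{P}_n$ which is PMH is the Cube graph, i.e. $\mathcal{P}_4$. In other words, $\mathcal{P}_n$ is PMH if and only if $n=4$.
   Context: All graphs are finite, simple and connected. A graph $G$ admitting a perfect matching is said to be PMH (to have the Perfect-Matching-Hamiltonian property) if for every perfect matching $M$ of $G$ there exists another perfect matching $N$ of $G$, with $M\cap N=\emptyset$, such that the edges of $M\cup N$ induce a Hamiltonian cycle of $G$. The $n$-prism graph $\mathcal{P}_n$ is the graph on the $2n$ vertices $\{u_i,v_i : i=1,\dots,n\}$ whose edges are exactly those of the two disjoint cycles $(u_1u_2\dots u_n)$ and $(v_1v_2\dots v_n)$ of length $n$, together with the edges $u_iv_i$ for $i=1,\dots,n$. *)

(* Defs.v *)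
From mathcomp Require Import all_boot.

Set Implicit Arguments.
Unset Strict Implicit.
Unset Printing Implicit Defensive.

(* A simple graph is a symmetric irreflexive adjacency relation on a finType;
   an edge is the two-element set of its end vertices. *)
Section PMH.
Variables (T : finType) (e : rel T).

Definition simple_graph : Prop := symmetric e /\ irreflexive e.

Definition connected_graph : Prop := forall x y : T, connect e x y.

Definition edges : {set {set T}} :=
  [set E | [exists x, exists y, e x y && (E == [set x; y])]].

Definition perfect_matching (M : {set {set T}}) : Prop :=
  M \subset edges /\ forall v : T, #|[set E in M | v \in E]| = 1.

(* The cycle is given by its cyclic sequence of vertices; the size condition
   excludes the degenerate closed walks [::], [:: x] and [:: x; y]. *)
Definition hamiltonian_cycle (c : seq T) : Prop :=
  [/\ 2 < size c, ucycle e c & forall v : T, v \in c].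

Definition cycle_edges (c : seq T) : {set {set T}} :=
  [set [set x; next c x] | x in c].

Definition PMH : Prop :=
  (exists M, perfect_matching M) /\
  forall M, perfect_matching M ->
    exists N, [/\ perfect_matching N, M :&: N = set0 &
      exists2 c, hamiltonian_cycle c & M :|: N = cycle_edges c].

End PMH.

(* [(false, i)] stands for u_i and [(true, i)] for v_i, with indices i counted
   from 0; [ordS] is the cyclic successor on ['I_n]. *)
Definition prism (n : nat) : rel (bool * 'I_n) := fun x y =>
  (x.1 == y.1) && ((y.2 == ordS x.2) || (x.2 == ordS y.2))
  || (x.1 != y.1) && (x.2 == y.2).

Lemma prism_simple (n : nat) : 2 < n -> simple_graph (@prism n).
Proof.
move=> n_gt2; split=> [x y|[b i]]; rewrite /prism.
  by rewrite (eq_sym x.1) (eq_sym x.2 y.2) orbC [in RHS]orbC [X in _ || _ && X]orbC.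
rewrite /= !eqxx orbF orbb /=; apply/negP=> /eqP/(congr1 val) /=.
have [lt_in|] := ltnP i.+1 n; first by rewrite modn_small // => /n_Sn.
move=> le_ni; have eqn : i.+1 = n by apply/eqP; rewrite eqn_leq le_ni ltn_ord.
by rewrite eqn modnn => i0; rewrite -eqn i0 in n_gt2.
Qed.

Lemma prism_connected (n : nat) : 2 < n -> connected_graph (@prism n).
Proof.
case: n => // n n_gt2.
have symC : connect_sym (@prism n.+1).
  by apply: sym_connect_sym; case: (prism_simple n_gt2).
suff from0 x : connect (@prism n.+1) (false, ord0) x.
  by move=> x y; apply: connect_trans (from0 y); rewrite symC.
have row0 k : k < n.+1 -> connect (@prism n.+1) (false, ord0) (false, inord k).
  elim: k => [_|k IHk lt_kn].
    suff -> : inord 0 = ord0 :> 'I_n.+1 by [].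
    by apply: val_inj; rewrite /= inordK.
  apply: connect_trans (IHk (ltnW lt_kn)) (connect1 _).
  rewrite /prism /=; apply/orP; left; apply/orP; left; apply/eqP/val_inj.
  by rewrite /= !inordK ?modn_small // ltnW.
case: x => b i; have ci := row0 i (ltn_ord i); rewrite inord_val in ci.
by case: b => //; apply: connect_trans ci (connect1 _); rewrite /prism /= eqxx.
Qed.

(* Main.v *)
Require Import Defs.
From mathcomp Require Import all_boot.

(** A perfect matching is the same thing as a fixed-point-free involution whose
    graph lies in the adjacency relation ([perfect_matchingP]), so everything
    is argued with partner functions. Two facts link them to Hamiltonian
    cycles. If two matchings together form a Hamiltonian cycle, the only
    nonempty set of vertices closed under both partner functions is the whole
    vertex set ([PMH_partner]). Conversely, if every perfect matching lies
    inside some Hamiltonian cycle, the graph is PMH, since the other edges of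
    the cycle form the matching that is sought ([PMH_of_cycles]).

    For [n = 3] take for M the three rungs: a matching disjoint from M would
    match each triangle within itself, an odd set. For [n > 4] take for M the edges u_1u_2
    and v_1v_2 together with all rungs except those of columns 1 and 2
    ([detour]). In a matching N disjoint from M, either both u_1 and v_1 are
    joined to column 0, or they are joined to each other; likewise for u_2, v_2
    and column 3. So columns 1 and 2, with column 0 in the first case and
    with column 3 in its analogue, are closed under M and N, and they miss
    column 4: the union of M and N is not a single cycle
    ([prism_large_not_PMH]).

    In the cube, call a perfect matching mixed if its edges are not all
    parallel. The complement of a mixed matching is a Hamiltonian cycle
    ([detour_complement], [zigzag_complement]), and every perfect matching is
    disjoint from some mixed one ([cube_matching_avoids]); hence it lies in a
    Hamiltonian cycle, and the cube is PMH. *)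

Set Implicit Arguments.
Unset Strict Implicit.
Unset Printing Implicit Defensive.

Lemma eq_set2 (T : finType) (x y z w : T) :
  [set x; y] = [set z; w] -> z = x /\ w = y \/ z = y /\ w = x.
Proof.
move=> eq_xy.
have : y \in [set z; w] by rewrite -eq_xy set22.
have : x \in [set z; w] by rewrite -eq_xy set21.
have : w \in [set x; y] by rewrite eq_xy set22.
have : z \in [set x; y] by rewrite eq_xy set21.
rewrite !inE => /orP[]/eqP-> /orP[]/eqP->; rewrite ?orbb.
- by move=> _ /eqP->; left.
- by left.
- by right.
by move=> /eqP-> _; left.
Qed.

(** * Perfect matchings as involutions *)

Section Matchings.
Variables (T : finType) (e : rel T).
Hypothesis simple_e : simple_graph e.

Definition matching_of (f : T -> T) : {set {set T}} :=
  [set [set x; f x] | x : T].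

Lemma mem_matching_of f : involutive f -> forall x y,
  ([set x; y] \in matching_of f) = (y == f x).
Proof.
move=> fK x y; apply/imsetP/eqP=> [[z _ /eq_set2[] [-> <-]]|->].
- by [].
- by rewrite fK.
by exists x.
Qed.

Lemma perfect_matching_of f :
  involutive f -> (forall x, e x (f x)) -> perfect_matching e (matching_of f).
Proof.
move=> fK ef; split.
  apply/subsetP=> _ /imsetP[x _ ->]; rewrite inE.
  by apply/existsP; exists x; apply/existsP; exists (f x); rewrite ef eqxx.
move=> v; apply/eqP/cards1P; exists [set v; f v]; apply/setP=> E; rewrite !inE.
apply/andP/eqP=> [[/imsetP[x _ ->]]|->].
  by rewrite !inE => /orP[]/eqP-> //; rewrite fK setUC.
by rewrite mem_matching_of // !inE !eqxx.
Qed.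

(** The partner of [v] is the other end of the unique edge of [M] at [v];
    uniqueness at the partner makes the function an involution. *)
Lemma perfect_matchingP M : perfect_matching e M ->
  exists f, [/\ involutive f, forall x, e x (f x) & M = matching_of f].
Proof.
have [sym_e irr_e] := simple_e.
case=> /subsetP sME M1.
have partner E v : E \in M -> v \in E -> exists2 w, E = [set v; w] & e v w.
  move/sME; rewrite inE => /existsP[x /existsP[y /andP[exy /eqP->]]].
  rewrite !inE => /orP[]/eqP->; first by exists y.
  by exists x; [rewrite setUC | rewrite sym_e].
have ex_partner v : exists w, [set v; w] \in M.
  have /eqP/cards1P[E EP] := M1 v; have := set11 E; rewrite -EP inE.
  by case/andP=> ME vE; have [w defE _] := partner E v ME vE; exists w; rewrite -defE.
pose f v := xchoose (ex_partner v).
have fM v : [set v; f v] \in M by exact: (xchooseP (ex_partner v)).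
have ef v : e v (f v).
  have [w /eq_set2[[_ ->]|[<- ->]] //] := partner _ v (fM v) (set21 v _).
have uniqE v E : E \in M -> v \in E -> E = [set v; f v].
  move=> ME vE; have /eqP/cards1P[F FP] := M1 v.
  have : E \in [set F] by rewrite -FP inE ME.
  have : [set v; f v] \in [set F] by rewrite -FP !inE fM eqxx.
  by rewrite !inE => /eqP-> /eqP.
exists f; split=> //.
- move=> v; have := uniqE (f v) _ (fM v) (set22 _ _).
  by case/eq_set2=> -[eq1 eq2] //; have := ef v; rewrite eq1 irr_e.
apply/setP=> E; apply/idP/imsetP=> [ME|[x _ ->] //].
have := sME E ME; rewrite inE => /existsP[x /existsP[y /andP[_ /eqP defE]]].
by exists x => //; apply: uniqE; rewrite // defE set21.
Qed.

(** * Matchings and Hamiltonian cycles *)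

Section HamiltonianCycle.
Variable c : seq T.
Hypothesis ham_c : hamiltonian_cycle e c.

Lemma next_closed (S : pred T) x0 :
  S x0 -> (forall x, S x -> S (next c x)) -> forall x, S x.
Proof.
have [_ /andP[_ Uc] c_all] := ham_c => Sx0 Snext x.
have : fconnect (next c) x0 x by rewrite (fconnect_cycle (cycle_next Uc)).
move/iter_findex <-; elim: (findex _ _ _) => //= k; exact: Snext.
Qed.

(** Otherwise [x] and [next c x] would already exhaust the cycle, which has
    more than two vertices. *)
Lemma next_neq_prev x : next c x != prev c x.
Proof.
have [size_c /andP[_ Uc] c_all] := ham_c.
apply/eqP=> eq_np; have nnx : next c (next c x) = x by rewrite eq_np next_prev.
have all2 : forall y, y \in [:: x; next c x].
  apply: (@next_closed (mem [:: x; next c x]) x) => /= [|y]; first by rewrite mem_head.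
  by rewrite !inE => /orP[]/eqP->; rewrite ?nnx eqxx ?orbT.
have := uniq_leq_size Uc (fun y _ => all2 y).
by rewrite leqNgt size_c.
Qed.

(** Each vertex has exactly two neighbours on the cycle, and [f] picks one of
    them; the new matching [g] picks the other. These choices agree at the two
    ends of an edge because those of the involution [f] do. *)
Lemma extend_to_cycle f :
    involutive f -> (forall x, f x = next c x \/ f x = prev c x) ->
  exists g, [/\ involutive g, forall x, e x (g x), forall x, g x != f x &
    matching_of f :|: matching_of g = cycle_edges c].
Proof.
have [sym_e irr_e] := simple_e; have [_ /andP[cyc_c Uc] c_all] := ham_c.
have np x : next c (prev c x) = x := next_prev Uc x.
have pn x : prev c (next c x) = x := prev_next Uc x.
move=> fK fc; pose g x := if f x == next c x then prev c x else next c x.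
have gP x : f x = next c x /\ g x = prev c x \/ f x = prev c x /\ g x = next c x.
  rewrite /g; case: (fc x) => ->; first by left; rewrite eqxx.
  by right; rewrite eq_sym (negbTE (next_neq_prev x)).
have gK : involutive g.
  move=> x; case: (gP x) => -[fx ->].
    case: (gP (prev c x)) => -[fy ->]; last exact: np.
    case/eqP: (next_neq_prev x).
    by rewrite -fx -[in LHS](np x) -fy fK.
  case: (gP (next c x)) => -[fy ->]; first exact: pn.
  case/eqP: (next_neq_prev x).
  by rewrite -fx -[in RHS](pn x) -fy fK.
exists g; split=> // [x|x|].
- case: (gP x) => -[_ ->]; last exact: next_cycle.
  by rewrite sym_e; exact: prev_cycle.
- have := next_neq_prev x.
  by case: (gP x) => -[-> ->] //; rewrite eq_sym.
apply/setP=> E; rewrite inE; apply/orP/imsetP.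
  case=> /imsetP[x _ ->]; case: (gP x) => -[fx gx].
  - by exists x; rewrite ?fx.
  - by exists (prev c x); rewrite // np fx setUC.
  - by exists (prev c x); rewrite // np gx setUC.
  by exists x; rewrite ?gx.
case=> x _ ->; case: (gP x) => -[fx gx]; [left | right]; apply/imsetP; exists x => //.
  by rewrite fx.
by rewrite gx.
Qed.

Lemma union_closed f g (S : pred T) x0 :
    involutive f -> involutive g ->
    matching_of f :|: matching_of g = cycle_edges c ->
    S x0 -> (forall x, S x -> S (f x)) -> (forall x, S x -> S (g x)) ->
  forall x, S x.
Proof.
have [_ _ c_all] := ham_c.
move=> fK gK cover Sx0 Sf Sg; apply: next_closed Sx0 _ => x Sx.
have : [set x; next c x] \in cycle_edges c by apply/imsetP; exists x.
rewrite -cover inE !mem_matching_of // => /orP[]/eqP->; [exact: Sf | exact: Sg].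
Qed.

End HamiltonianCycle.

Lemma matching_of_disjoint f g : involutive f -> involutive g ->
  (matching_of f :&: matching_of g == set0) = [forall x, g x != f x].
Proof.
move=> fK gK; apply/eqP/forallP=> [dis x|neq_fg].
  apply/eqP=> eq_fg; have /setP/(_ [set x; f x]) := dis.
  by rewrite !inE !mem_matching_of // eq_fg eqxx.
apply/setP=> E; rewrite !inE; apply/andP=> -[/imsetP[x _ ->]].
by rewrite mem_matching_of // eq_sym (negbTE (neq_fg x)).
Qed.

Lemma PMH_of_cycles f0 :
    involutive f0 -> (forall x, e x (f0 x)) ->
    (forall f, involutive f -> (forall x, e x (f x)) ->
       exists2 c, hamiltonian_cycle e c &
         forall x, f x = next c x \/ f x = prev c x) ->
  PMH e.
Proof.
move=> f0K ef0 cycles; split; first by exists (matching_of f0); apply: perfect_matching_of.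
move=> _ /perfect_matchingP[f [fK ef ->]].
have [c ham_c fc] := cycles f fK ef.
have [g [gK eg neq_fg cover]] := extend_to_cycle ham_c fK fc.
exists (matching_of g); split; [exact: perfect_matching_of | | by exists c].
by apply/eqP; rewrite matching_of_disjoint //; apply/forallP.
Qed.

(** The form in which the PMH property is refuted: to exclude a disjoint matching
    [g] that completes [f] to a Hamiltonian cycle, it is enough to find a proper
    nonempty set of vertices closed under [f] and [g]. *)
Lemma PMH_partner f : PMH e -> involutive f -> (forall x, e x (f x)) ->
  exists g, [/\ involutive g, forall x, e x (g x), forall x, g x != f x &
    forall (S : pred T) x0, S x0 ->
      (forall x, S x -> S (f x)) -> (forall x, S x -> S (g x)) -> forall x, S x].
Proof.
move=> [_ ext] fK ef.
have [N [pmN dis [c ham_c cover]]] := ext _ (perfect_matching_of fK ef).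
have [g [gK eg defN]] := perfect_matchingP pmN; subst N.
exists g; split=> //.
  by apply/forallP; rewrite -matching_of_disjoint //; apply/eqP.
by move=> S x0; apply: union_closed cover.
Qed.

End Matchings.

(** * Matchings of prisms *)

Section Prism.
Variable n : nat.
Implicit Type x : bool * 'I_n.

Definition rung x : bool * 'I_n := (~~ x.1, x.2).

Lemma rungK : involutive rung.
Proof. by case=> b i; rewrite /rung negbK. Qed.

Lemma prism_rung x : prism x (rung x).
Proof. by case: x => b i; rewrite /prism /= eqxx andbT; case: b. Qed.

Lemma prism_ordS b (i : 'I_n) : prism (b, i) (b, ordS i).
Proof. by rewrite /prism !eqxx. Qed.

Lemma prism_cases x y : prism x y ->
  [\/ y = (x.1, ordS x.2), y = (x.1, ord_pred x.2) | y = rung x].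
Proof.
case: x y => [b i] [b' j]; rewrite /prism /rung /=.
case/orP=> /andP[].
  move/eqP=> <- /orP[]/eqP->; first by constructor 1.
  by rewrite ordSK; constructor 2.
by case: b b' => [] [] // _ /eqP->; constructor 3.
Qed.

(** This matching serves twice: in a long prism no Hamiltonian cycle contains it,
    whereas in the cube its complement is a Hamiltonian cycle. *)
Definition detour (i : 'I_n) x : bool * 'I_n :=
  if x.2 == i then (x.1, ordS i) else if x.2 == ordS i then (x.1, i) else rung x.

Lemma detourK i : involutive (detour i).
Proof.
case=> b j; rewrite [X in detour i X]/detour /=.
case: (eqVneq j i) => [->|ji]; last case: (eqVneq j (ordS i)) => [->|jSi].
- by rewrite /detour /= eqxx; case: eqP => // ->.
- by rewrite /detour /= eqxx.
by rewrite /detour /= (negbTE ji) (negbTE jSi) rungK.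
Qed.

Lemma prism_detour i x : prism x (detour i x).
Proof.
case: x => b j; rewrite /detour /=; case: eqP => [->|_]; first exact: prism_ordS.
case: eqP => [->|_]; last exact: prism_rung.
by rewrite /prism !eqxx orbT.
Qed.

(** Disjointness from [detour i] need only be tested once per edge, since both
    functions are involutions. *)
Lemma neq_detour f i : involutive f ->
    (forall b, f (b, i) <> (b, ordS i)) ->
    (forall j, j != i -> j != ordS i -> f (false, j) <> (true, j)) ->
  forall x, f x != detour i x.
Proof.
move=> fK not_row not_rung [b j]; apply/eqP; rewrite /detour /=.
case: eqP => [->|/eqP ji]; first exact: not_row.
case: eqP => [-> fSi|/eqP jSi]; first by case: (not_row b); rewrite -fSi fK.
move=> fj; case: (not_rung j ji jSi); case: b fj => // fj.
by rewrite -[(false, j)]fj fK.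
Qed.

End Prism.

(** * Prisms that are not PMH *)

(** Disjointness from the rungs forces the partner function to act on the
    triangle of the u_i as a fixed-point-free involution, which is impossible
    on three points: whoever is matched, the third vertex is left over. *)
Lemma prism3_not_PMH : ~ PMH (@prism 3).
Proof.
move=> pmh.
have [g [gK eg neq_g _]] :=
  PMH_partner (prism_simple (ltnSn 2)) pmh (@rungK 3) (@prism_rung 3).
have gE i : g (false, i) = (false, ordS i) \/ g (false, i) = (false, ord_pred i).
  case: (prism_cases (eg (false, i))) => gi; [by left | by right |].
  by have := neq_g (false, i); rewrite gi eqxx.
have no_succ i : g (false, i) <> (false, ordS i).
  move=> gi; have gSi : g (false, ordS i) = (false, i) by rewrite -gi gK.
  have [S3 neqS] : ordS (ordS (ordS i)) = i /\ ordS i != i.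
    by case: i {gi gSi} => [[|[|[|]]]] // lt_i; split=> //; apply: val_inj.
  have gSS : g (g (false, ordS (ordS i))) = (false, ordS (ordS i)) by exact: gK.
  case: (gE (ordS (ordS i))) => gSSi; rewrite gSSi ?ordSK ?S3 ?gi ?gSi in gSS.
    have eqS : ordS i = ordS (ordS i) by apply: (congr1 snd gSS).
    by case/eqP: neqS; rewrite -[RHS]S3 -!eqS.
  have eqS : i = ordS (ordS i) by apply: (congr1 snd gSS).
  by case/eqP: neqS; rewrite -[RHS]S3 -eqS.
case: (gE ord0) => [|g0]; first exact: no_succ.
by apply: (no_succ (ord_pred ord0)); rewrite -g0 gK ord_predK.
Qed.

(** The column [c4] outside the closed set [S] exists exactly because [n > 4]. *)
Lemma prism_large_not_PMH n : 4 < n -> ~ PMH (@prism n).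
Proof.
case: n => // -[|[|[|[|m]]]] // n_gt4 pmh.
pose c0 : 'I_m.+4.+1 := @Ordinal m.+4.+1 0 isT.
pose c1 : 'I_m.+4.+1 := @Ordinal m.+4.+1 1 isT.
pose c2 : 'I_m.+4.+1 := @Ordinal m.+4.+1 2 isT.
pose c3 : 'I_m.+4.+1 := @Ordinal m.+4.+1 3 isT.
pose c4 : 'I_m.+4.+1 := @Ordinal m.+4.+1 4 isT.
have S0 : ordS c0 = c1 by apply: val_inj; rewrite /= modn_small.
have S1 : ordS c1 = c2 by apply: val_inj; rewrite /= modn_small.
have S2 : ordS c2 = c3 by apply: val_inj; rewrite /= modn_small.
have detourE x : detour c1 x =
    if x.2 == c1 then (x.1, c2) else if x.2 == c2 then (x.1, c1) else rung x.
  by rewrite /detour S1.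
have [g [gK eg neq_g closed]] :=
  PMH_partner (@prism_simple m.+4.+1 isT) pmh (detourK c1) (prism_detour c1).
have g1 b : g (b, c1) = (b, c0) \/ g (b, c1) = (~~ b, c1).
  case: (prism_cases (eg (b, c1))) => /= g1; [| | by right].
    by have := neq_g (b, c1); rewrite g1 S1 detourE eqxx.
  by left; rewrite g1 -S0 ordSK.
have g2 b : g (b, c2) = (b, c3) \/ g (b, c2) = (~~ b, c2).
  case: (prism_cases (eg (b, c2))) => /= g2; [| | by right].
    by left; rewrite g2 S2.
  by have := neq_g (b, c2); rewrite g2 detourE -S1 ordSK /= S1 eqxx.
(* If one copy of [c1] leaves its column, its neighbour along the rung has lost
   both other options and leaves in the same direction; likewise for [c2]. *)
have g1C b : g (b, c1) = (b, c0) -> g (~~ b, c1) = (~~ b, c0).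
  move=> gb; case: (g1 (~~ b)) => // /(congr1 g); rewrite gK negbK gb.
  by case: b {gb}.
have g2C b : g (b, c2) = (b, c3) -> g (~~ b, c2) = (~~ b, c3).
  move=> gb; case: (g2 (~~ b)) => // /(congr1 g); rewrite gK negbK gb.
  by case: b {gb}.
(* On [S] the union of the two matchings is a cycle of length 4, 6 or 8. *)
pose S : pred (bool * 'I_m.+4.+1) := fun x =>
  [|| x.2 == c1, x.2 == c2,
      (x.2 == c0) && (g (x.1, c1) == (x.1, c0))
    | (x.2 == c3) && (g (x.1, c2) == (x.1, c3))].
suff : S (false, c4) by [].
apply: (closed S (false, c1)) => // {closed} -[b i]; rewrite /S ?detourE /=.
  case/or4P=> [/eqP->|/eqP->|/andP[/eqP-> /eqP gb]|/andP[/eqP-> /eqP gb]] //=.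
    by rewrite g1C ?eqxx.
  by rewrite g2C ?eqxx.
case/or4P=> [/eqP->|/eqP->|/andP[/eqP-> /eqP gb]|/andP[/eqP-> /eqP gb]].
- by case: (g1 b) => gb; rewrite gb //= gb eqxx.
- by case: (g2 b) => gb; rewrite gb //= gb eqxx ?orbT.
- by rewrite -gb gK eqxx.
by rewrite -gb gK eqxx orbT.
Qed.

(** * The cube *)

(** The mixed matchings of the cube without rungs: their edges alternate between
    the two rows as one goes round. Together with the four matchings [detour i]
    they are all the mixed ones. *)
Definition zigzag (p : bool) (x : bool * 'I_4) : bool * 'I_4 :=
  (x.1, if odd (x.1 + x.2) == p then ordS x.2 else ord_pred x.2).

(** The analogue of [neq_detour]: going one column back changes the parity of
    [b + j], so each edge of the zigzag is tested from its first end. *)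
Lemma neq_zigzag (f : bool * 'I_4 -> bool * 'I_4) p : involutive f ->
    (forall (b : bool) (j : 'I_4), odd (b + j) = p -> f (b, j) <> (b, ordS j)) ->
  forall x, f x != zigzag p x.
Proof.
move=> fK not_row [b j]; apply/eqP; rewrite /zigzag /=.
case: eqP => [|/eqP odd_bj fj]; first exact: not_row.
case: (not_row b (ord_pred j)); last by rewrite -fj fK ord_predK.
by case: j {fj} odd_bj => [[|[|[|[|]]]]] //= _; case: b p {not_row} => [] [].
Qed.

(** Without the edges of [detour i], what is left runs once along each row, from
    column [ordS i] round to column [i], and the two runs are closed up by the
    rungs of these two columns. *)
Lemma detour_complement (i : 'I_4) :
  exists2 c, hamiltonian_cycle (@prism 4) c &
    forall x y, prism x y -> y != detour i x -> y = next c x \/ y = prev c x.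
Proof.
pose r := traject (@ordS 4) (ordS i) 4.
exists ([seq (false, j) | j <- r] ++ rev [seq (true, j) | j <- r]).
  split=> //; rewrite {}/r.
    by case: i => [[|[|[|[|//]]]] ?]; vm_compute.
  case=> b j; case: i => [[|[|[|[|//]]]] ?];
    by case: j => [[|[|[|[|//]]]] ?]; case: b; vm_compute.
move=> x y xy xDy; apply/pred2P; move: xy xDy; rewrite {}/r.
case: x y => [b j] [b' k]; case: i => [[|[|[|[|//]]]] ?].
all: case: j => [[|[|[|[|//]]]] ?]; case: k => [[|[|[|[|//]]]] ?].
all: by case: b b' => [] []; vm_compute.
Qed.

(** Without the edges of [zigzag p], what is left alternates between rungs and
    row edges, and it goes once round the prism. *)
Lemma zigzag_complement p :
  exists2 c, hamiltonian_cycle (@prism 4) c &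
    forall x y, prism x y -> y != zigzag p x -> y = next c x \/ y = prev c x.
Proof.
pose o0 : 'I_4 := ord0; pose o1 := ordS o0; pose o2 := ordS o1; pose o3 := ordS o2.
exists [:: (p, o0); (~~ p, o0); (~~ p, o1); (p, o1);
           (p, o2); (~~ p, o2); (~~ p, o3); (p, o3)].
  split=> //; first by case: p; vm_compute.
  by case=> b [[|[|[|[|//]]]] ?]; case: b p => [] []; vm_compute.
move=> x y xy xDy; apply/pred2P; move: xy xDy; case: x y => [b j] [b' k].
case: j => [[|[|[|[|//]]]] ?]; case: k => [[|[|[|[|//]]]] ?].
all: by case: b b' p => [] [] []; vm_compute.
Qed.

(** The twelve booleans tell which edges belong to a matching: [r_j] is the rung
    of column [j], and [a_j], [b_j] are the row edges from column [j] to the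
    next one. There is one hypothesis per vertex, and one alternative per mixed
    matching to be avoided. *)
Lemma cube_selection (r0 r1 r2 r3 a0 a1 a2 a3 b0 b1 b2 b3 : bool) :
    r1 + a1 + a0 = 1 -> r2 + a2 + a1 = 1 -> r3 + a3 + a2 = 1 -> r0 + a0 + a3 = 1 ->
    r1 + b1 + b0 = 1 -> r2 + b2 + b1 = 1 -> r3 + b3 + b2 = 1 -> r0 + b0 + b3 = 1 ->
  [|| [|| ~~ [|| a0, b0, r2 | r3], ~~ [|| a1, b1, r3 | r0],
          ~~ [|| a2, b2, r0 | r1] | ~~ [|| a3, b3, r1 | r2]],
      ~~ [|| a0, a2, b1 | b3] | ~~ [|| a1, a3, b0 | b2]].
Proof.
case: r0; case: r1; case: r2; case: r3; case: a0 => //; case: a1 => //.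
all: case: a2 => //; case: a3 => //; case: b0 => //; case: b1 => //.
all: by case: b2 => //; case: b3.
Qed.

(** The partner function is translated into the edge indicators of
    [cube_selection] ([A] for row edges, [R] for rungs), where the claim is a
    finite check. It is true because each set of four parallel edges misses some
    mixed matching with no edge in its direction, and because the mixed
    matchings come in disjoint pairs: [detour i] with [detour] of the opposite
    column, and the two zigzags with each other. *)
Lemma cube_matching_avoids f : involutive f -> (forall x, @prism 4 x (f x)) ->
  (exists i, forall x, f x != detour i x) \/
  (exists p, forall x, f x != zigzag p x).
Proof.
move=> fK ef.
pose A b j := f (b, j) == (b, ordS j); pose R j := f (false, j) == (true, j).
have one b j : R (ordS j) + A b (ordS j) + A b j = 1.
  have -> : A b j = (f (b, ordS j) == (b, j)).
    by apply/eqP/eqP=> e_f; rewrite -e_f fK.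
  have -> : R (ordS j) = (f (b, ordS j) == (~~ b, ordS j)).
    by case: b => //; apply/eqP/eqP=> e_f; rewrite -[RHS]fK e_f.
  by rewrite /A; case: (prism_cases (ef (b, ordS j))) => ->; case: b;
    case: j => [[|[|[|[|//]]]] ?]; vm_compute.
pose o0 : 'I_4 := ord0; pose o1 := ordS o0; pose o2 := ordS o1; pose o3 := ordS o2.
have S3 : ordS o3 = o0 by apply: val_inj.
have all_o (P : 'I_4 -> Prop) : P o0 -> P o1 -> P o2 -> P o3 -> forall j, P j.
  move=> P0 P1 P2 P3 j; have : [|| j == o0, j == o1, j == o2 | j == o3].
    by case: j => [[|[|[|[|//]]]] ?].
  by case/or4P=> /eqP->.
have avoid_detour i :
    ~~ [|| A false i, A true i, R (ordS (ordS i)) | R (ordS (ordS (ordS i)))] ->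
  exists k, forall x, f x != detour k x.
  case/norP=> Af /norP[At /norP[R2 R3]]; exists i; apply: neq_detour => // [[]|j ji jSi].
  - exact/eqP.
  - exact/eqP.
  apply/eqP; have : [|| j == i, j == ordS i, j == ordS (ordS i)
                      | j == ordS (ordS (ordS i))].
    move: i j {Af At R2 R3 ji jSi}.
    by case=> [[|[|[|[|//]]]] ?]; case=> [[|[|[|[|//]]]] ?]; vm_compute.
  by case/or4P=> /eqP def_j; rewrite def_j ?eqxx // in ji jSi *.
have := one true o3; have := one false o3; rewrite S3 => one_f3 one_t3.
have := cube_selection (one false o0) (one false o1) (one false o2) one_f3
                       (one true o0) (one true o1) (one true o2) one_t3.
case/or3P=> [/or4P[] H | H | H].
- by left; apply: (avoid_detour o0).
- by left; apply: (avoid_detour o1); rewrite -/o2 -/o3 S3.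
- by left; apply: (avoid_detour o2); rewrite -/o3 S3.
- by left; apply: (avoid_detour o3); rewrite S3.
- right; exists false; apply: neq_zigzag => // b j odd_bj; apply/eqP; rewrite -/(A b j).
  by case/norP: H b j odd_bj => a0 /norP[a2 /norP[b1 b3]] [] j; elim/all_o: j.
right; exists true; apply: neq_zigzag => // b j odd_bj; apply/eqP; rewrite -/(A b j).
by case/norP: H b j odd_bj => a0 /norP[a2 /norP[b1 b3]] [] j; elim/all_o: j.
Qed.

Lemma prism4_PMH : PMH (@prism 4).
Proof.
apply: (PMH_of_cycles (@prism_simple 4 isT) (@rungK 4) (@prism_rung 4)) => f fK ef.
case: (cube_matching_avoids fK ef) => [[i neq_f]|[p neq_f]].
  by have [c ham_c cP] := detour_complement i; exists c => // x; apply: cP.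
by have [c ham_c cP] := zigzag_complement p; exists c => // x; apply: cP.
Qed.

Theorem theorem2p1 (n : nat) (hn : 3 <= n) : PMH (@prism n) <-> n = 4.
Proof.
split=> [pmh|->]; last exact: prism4_PMH.
case: (ltngtP n 4) => // n4; last by case: (prism_large_not_PMH n4 pmh).
have n3 : n = 3 by apply/eqP; rewrite eqn_leq hn andbT.
by rewrite n3 in pmh; case: (prism3_not_PMH pmh).
Qed.
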